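(* Suppose that $R$ is a ring and $G$ is a group. If the group ring $RG$ is strongly $J^{\#}$-clean, then $R$ is strongly $J^{\#}$-clean and $G$ is a $2$-group.
   Context: All rings are assumed to be unital and associative. $J(R)$ denotes the Jacobson radical of $R$ and $J^{\#}(R)=\{z\in R : z^n\in J(R)\text{ for some } n\ge 1\}$. A ring $R$ is strongly $J^{\#}$-clean if every element of $R$ is the sum of an idempotent from $R$ and an element from $J^{\#}(R)$ that commute with each other. $RG$ denotes the group ring of $G$ over $R$. A group $G$ is a $2$-group if every element of $G$ has finite order that is a power of $2$.
   Formalization: The ring R is assumed to be nonzero: for R = 0 the group ring RG is zero and hence strongly J#-clean for every group G, for example Z/3, so the claim that G is a 2-group would fail. *)

(* Defs.v *)
From HB Require Import structures.
From mathcomp Require Import all_boot all_order all_algebra finmap.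
From mathcomp.multinomials Require Import monalg.

Set Implicit Arguments.
Unset Strict Implicit.
Unset Printing Implicit Defensive.

Import GRing.Theory.

Local Open Scope ring_scope.

Section JsharpClean.
Variable R : pzRingType.
Implicit Types I M : R -> Prop.

Definition left_ideal I : Prop :=
  [/\ I 0, forall x y, I x -> I y -> I (x + y) & forall a x, I x -> I (a * x)].

Definition maximal_left_ideal M : Prop :=
  [/\ left_ideal M, ~ M 1 &
      forall I, left_ideal I -> ~ I 1 -> (forall x, M x -> I x) ->
      forall x, I x -> M x].

Definition jacobson_radical (x : R) : Prop :=
  forall M, maximal_left_ideal M -> M x.

Definition Jsharp (z : R) : Prop :=
  exists n : nat, (1 <= n)%N /\ jacobson_radical (z ^+ n).

Definition strongly_Jsharp_clean : Prop :=
  forall a : R, exists e z : R,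
    [/\ a = e + z, e * e = e, Jsharp z & e * z = z * e].

End JsharpClean.

Arguments strongly_Jsharp_clean : clear implicits.

Definition has_order (G : groupType) (g : G) (n : nat) : Prop :=
  [/\ (0 < n)%N, (g ^+ n)%g = 1%g &
      forall m : nat, (0 < m)%N -> (g ^+ m)%g = 1%g -> (n <= m)%N].

Definition two_group (G : groupType) : Prop :=
  forall g : G, exists k : nat, has_order g (2 ^ k)%N.

(* [{malg R[G]}] is the additive group of finitely supported functions from G  *)
(* to R. The product of [monalg] is not available on it: a [monomType] only    *)
(* has trivial units, so no nontrivial group is one. The alias [group_ring]    *)
(* carries the convolution product instead.                                    *)
Definition group_ring (R : nzRingType) (G : groupType) : Type := {malg R[G]}.

Section GroupRing.
Variables (R : nzRingType) (G : groupType).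

HB.instance Definition _ := GRing.Zmodule.on (group_ring R G).

Implicit Types x y : group_ring R G.

Definition gr_one : group_ring R G := << 1 *g 1%g >>.

Definition gr_mul x y : group_ring R G :=
  \sum_(g <- msupp x) \sum_(h <- msupp y) << x@_g * y@_h *g (g * h)%g >>.

Lemma gr_mulEw (d1 d2 : {fset G}) x y :
  (msupp x `<=` d1)%fset -> (msupp y `<=` d2)%fset ->
  gr_mul x y =
  \sum_(g <- d1) \sum_(h <- d2) << x@_g * y@_h *g (g * h)%g >>.
Proof.
move=> le_d1 le_d2; rewrite /gr_mul (big_fset_incl _ le_d1) /=.
  apply/eq_bigr=> g _; apply/big_fset_incl => // h _ /mcoeff_outdom ->.
  by rewrite mulr0 monalgU0.
move=> g _ /mcoeff_outdom xg.
by rewrite big1 // => h _; rewrite xg mul0r monalgU0.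
Qed.

Lemma gr_mul0l : left_zero 0 gr_mul.
Proof. by move=> x; rewrite /gr_mul msupp0 big_seq_fset0. Qed.

Lemma gr_mul0r : right_zero 0 gr_mul.
Proof.
by move=> x; rewrite /gr_mul big1 // => g _; rewrite msupp0 big_seq_fset0.
Qed.

Lemma gr_mulUl c g y :
  gr_mul << c *g g >> y = \sum_(h <- msupp y) << c * y@_h *g (g * h)%g >>.
Proof.
rewrite (gr_mulEw msuppU_le (fsubset_refl _)) big_seq_fset1.
by apply/eq_bigr => h _; rewrite mcoeffUU.
Qed.

Lemma gr_mulUr c h x :
  gr_mul x << c *g h >> = \sum_(g <- msupp x) << x@_g * c *g (g * h)%g >>.
Proof.
rewrite (gr_mulEw (fsubset_refl _) msuppU_le).
by apply/eq_bigr => g _; rewrite big_seq_fset1 mcoeffUU.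
Qed.

Lemma gr_mulUU c1 c2 g1 g2 :
  gr_mul << c1 *g g1 >> << c2 *g g2 >> = << c1 * c2 *g (g1 * g2)%g >>.
Proof. by rewrite (gr_mulEw msuppU_le msuppU_le) !big_seq_fset1 !mcoeffUU. Qed.

Lemma gr_mulEl x y :
  gr_mul x y = \sum_(g <- msupp x) gr_mul << x@_g *g g >> y.
Proof. by apply/eq_bigr => g _; rewrite gr_mulUl. Qed.

Lemma gr_mulEr x y :
  gr_mul x y = \sum_(h <- msupp y) gr_mul x << y@_h *g h >>.
Proof.
by rewrite {1}/gr_mul exchange_big; apply/eq_bigr => h _; rewrite gr_mulUr.
Qed.

Lemma gr_mul1l : left_id gr_one gr_mul.
Proof.
move=> x; rewrite gr_mulUl [RHS]monalgE.
by apply/eq_bigr => g _; rewrite mul1r mul1g.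
Qed.

Lemma gr_mul1r : right_id gr_one gr_mul.
Proof.
move=> x; rewrite gr_mulUr [RHS]monalgE.
by apply/eq_bigr => g _; rewrite mulr1 mulg1.
Qed.

Lemma gr_mulDl : left_distributive gr_mul +%R.
Proof.
move=> x y z; have sz := fsubset_refl (msupp z).
rewrite (gr_mulEw (msuppD_le x y) sz).
rewrite (gr_mulEw (fsubsetUl (msupp x) (msupp y)) sz).
rewrite (gr_mulEw (fsubsetUr (msupp x) (msupp y)) sz).
rewrite -big_split /=; apply/eq_bigr => g _.
rewrite -big_split /=; apply/eq_bigr => h _.
by rewrite mcoeffD mulrDl monalgUD.
Qed.

Lemma gr_mulDr : right_distributive gr_mul +%R.
Proof.
move=> z x y; have sz := fsubset_refl (msupp z).
rewrite (gr_mulEw sz (msuppD_le x y)).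
rewrite (gr_mulEw sz (fsubsetUl (msupp x) (msupp y))).
rewrite (gr_mulEw sz (fsubsetUr (msupp x) (msupp y))).
rewrite -big_split /=; apply/eq_bigr => g _.
rewrite -big_split /=; apply/eq_bigr => h _.
by rewrite mcoeffD mulrDr monalgUD.
Qed.

Lemma gr_mulA : associative gr_mul.
Proof.
move=> x y z.
rewrite [RHS](big_morph (gr_mul^~ _) (fun _ _ => gr_mulDl _ _ _) (gr_mul0l _)).
rewrite gr_mulEl; apply/eq_bigr => g _.
rewrite [LHS](big_morph (gr_mul _) (fun _ _ => gr_mulDr _ _ _) (gr_mul0r _)).
rewrite [RHS](big_morph (gr_mul^~ _) (fun _ _ => gr_mulDl _ _ _) (gr_mul0l _)).
apply/eq_bigr => h _.
rewrite [LHS](big_morph (gr_mul _) (fun _ _ => gr_mulDr _ _ _) (gr_mul0r _)).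
by rewrite gr_mulEr; apply/eq_bigr => k _; rewrite !gr_mulUU mulrA mulgA.
Qed.

Lemma gr_one_neq0 : gr_one != 0.
Proof. by rewrite monalgU_eq0 oner_eq0. Qed.

HB.instance Definition _ := GRing.Zmodule_isNzRing.Build (group_ring R G)
  gr_mulA gr_mul1l gr_mul1r gr_mulDl gr_mulDr gr_one_neq0.

End GroupRing.

(* Main.v *)
Require Import Defs.
From HB Require Import structures.
From mathcomp Require Import all_boot all_order all_algebra.
From mathcomp Require Import finmap boolp classical_sets.
From mathcomp.multinomials Require Import monalg.

(** The ring R is the image of RG under the augmentation, and a surjective ring
    morphism maps the Jacobson radical into the Jacobson radical, because
    preimages of maximal left ideals are maximal. Hence strong J#-cleanness
    descends from RG to R ([clean_surjective]).

    For the group, write a unit u of a strongly J#-clean ring S as e + z. The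
    idempotent 1 - e annihilates e, so on it u acts as z, which is nilpotent
    modulo J(S); as u is a unit, 1 - e lies in J(S) and therefore vanishes.
    Thus u - 1 is in J#(S) ([clean_unit_subr1]). With u = -1 some power of 2 is
    in J(S), hence so is 2 itself ([clean_jacobson2]); then, as
    (u - 1)^(2^k) = u^(2^k) - 1 modulo 2, one gets u^(2^k) - 1 in J(S) for a
    suitable k ([clean_unit_pow2]).

    Take S = RG and u = g in G, and put h = g^(2^k), so that h - 1 is in J(RG).
    For odd m the sum 1 + h + ... + h^(m-1) is congruent to m, hence to 1,
    modulo J(RG), so it has a left inverse y, and y (h^m - 1) = h - 1
    ([jacobson_subr1_multiple]). This is used twice. For m = 3, comparing
    coefficients along the powers of h^3 would make the support of y infinite
    if h had infinite order ([elt_subr1_multiple_torsion]); so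
    h^(2^a m) = 1 for some a and some odd m. Applied to h^(2^a) and this m, the
    left-hand side is zero, whence h^(2^a) = 1 and g has 2-power order. *)

Set Implicit Arguments.
Unset Strict Implicit.
Unset Printing Implicit Defensive.

Import GRing.Theory.

Local Open Scope ring_scope.

(** * The Jacobson radical and strongly J#-clean rings *)

Section Jacobson.
Variable R : pzRingType.
Implicit Types (I M : R -> Prop) (x y z : R).

Lemma maximal_left_ideal_exists I : left_ideal I -> ~ I 1 ->
  exists2 M, maximal_left_ideal M & forall x, I x -> M x.
Proof.
move=> [I0 Iadd Imul] I1.
(* The chain in Zorn's lemma may be empty and its union is then empty, so P must
   hold of the empty set: containment of I is only asked of inhabited sets. *)
pose P (X : set R) := [/\ forall x y, X x -> X y -> X (x + y),
  forall a x, X x -> X (a * x), ~ X 1 &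
  forall y, X y -> forall z, I z -> X z].
have [F FP Ftot|A [[Aadd Amul A1 AI] Amax]] := @Zorn_bigcup R P.
  split=> [x y [X FX Xx] [Y FY Yy]|a x [X FX Xx]|[X FX X1]|y [X FX Xy] z Iz].
  - have [XY|YX] := Ftot _ _ FX FY.
      by exists Y => //; have [Yadd _ _ _] := FP _ FY; apply: Yadd => //; exact: XY.
    by exists X => //; have [Xadd _ _ _] := FP _ FX; apply: Xadd => //; exact: YX.
  - by exists X => //; have [_ Xmul _ _] := FP _ FX; exact: Xmul.
  - by have [_ _ + _] := FP _ FX; apply.
  - by exists X => //; have [_ _ _ XI] := FP _ FX; exact: XI _ Xy _ Iz.
have PI : P I by split.
have IA x : I x -> A x.
  have [[y Ay]|A0] := pselect (exists y, A y); first exact: AI _ Ay x.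
  have [] := Amax I _ PI; split; first by move=> y Ay; case: A0; exists y.
  by move=> /(_ 0 I0) Ay; apply: A0; exists 0.
exists A => //; split=> //; first by split=> //; exact: IA.
move=> J [J0 Jadd Jmul] J1 AJ x Jx; apply: contrapT => nAx.
apply: (Amax J); first by split=> // JA; exact/nAx/JA.
by split=> // _ _ z /IA/AJ.
Qed.

Lemma jacobson_left_ideal : left_ideal (@jacobson_radical R).
Proof.
split=> [M [[]]//|x y Jx Jy M maxM|a x Jx M maxM]; have [[_ Madd Mmul] _ _] := maxM.
  by apply: Madd; [exact: Jx|exact: Jy].
by apply: Mmul; exact: Jx.
Qed.

Lemma jacobson0 : jacobson_radical (0 : R).
Proof. by have [] := jacobson_left_ideal. Qed.

Lemma jacobsonD x y :
  jacobson_radical x -> jacobson_radical y -> jacobson_radical (x + y).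
Proof. by have [_ + _] := jacobson_left_ideal; apply. Qed.

Lemma jacobsonM x y : jacobson_radical y -> jacobson_radical (x * y).
Proof. by have [_ _] := jacobson_left_ideal; apply. Qed.

Lemma jacobsonN x : jacobson_radical x -> jacobson_radical (- x).
Proof. by rewrite -mulN1r; exact: jacobsonM. Qed.

(** Otherwise the left ideal generated by 1 - x would be contained in a maximal
    one, which contains x too, and hence 1. *)
Lemma jacobson_left_invertible x :
  jacobson_radical x -> exists y, y * (1 - x) = 1.
Proof.
move=> Jx; apply: contrapT => noy.
pose I z := exists y, y * (1 - x) = z.
have lI : left_ideal I.
  split=> [|_ _ [y1 <-] [y2 <-]|a _ [y <-]]; first by exists 0; rewrite mul0r.
    by exists (y1 + y2); rewrite mulrDl.
  by exists (a * y); rewrite mulrA.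
have [M maxM IM] := maximal_left_ideal_exists lI noy.
have [[_ Madd _] M1 _] := maxM; apply: M1.
by rewrite -(subrK x 1); apply: Madd (Jx _ maxM); apply: IM; exists 1; rewrite mul1r.
Qed.

Lemma jacobson_idempotent_eq0 (e : R) :
  e * e = e -> jacobson_radical e -> e = 0.
Proof.
move=> ee /jacobson_left_invertible[y ye].
by rewrite -[e]mul1r -ye -mulrA mulrBl mul1r ee subrr mulr0.
Qed.

(** A maximal left ideal M is prime with respect to central elements: if M does
    not contain c, then 1 = m + a c with m in M, so that c^(k+1) in M forces
    c^k = c^k m + a c^(k+1) in M, down to k = 0. *)
Lemma jacobson_central_expr (c : R) n : (forall x : R, GRing.comm c x) ->
  jacobson_radical (c ^+ n) -> jacobson_radical c.
Proof.
move=> cC Jcn M maxM; have [[M0 Madd Mmul] M1 Mmax] := maxM.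
apply: contrapT => nMc.
pose I z := exists m a, M m /\ z = m + a * c.
have lI : left_ideal I.
  split=> [|_ _ [m [a [Mm ->]]] [m' [a' [Mm' ->]]]|b _ [m [a [Mm ->]]]].
  - by exists 0, 0; rewrite mul0r addr0.
  - by exists (m + m'), (a + a'); rewrite mulrDl addrACA; split=> //; exact: Madd.
  - by exists (b * m), (b * a); rewrite mulrDr mulrA; split=> //; exact: Mmul.
have I1 : I 1.
  apply: contrapT => nI1; apply/nMc/(Mmax I lI nI1) => [x Mx|].
    by exists x, 0; rewrite mul0r addr0.
  by exists 0, 1; rewrite mul1r add0r.
have [m [a [Mm Dm]]] := I1.
suff MI k : M (c ^+ k) -> M 1 by apply/M1/(MI n); exact: Jcn.
elim: k => [|k IHk] Mck; first by rewrite -(expr0 c).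
apply: IHk; rewrite -[c ^+ k]mulr1 Dm mulrDr; apply: Madd; first exact: Mmul.
rewrite mulrA (commr_sym (commrX k (commr_sym (cC a)))) -mulrA -exprSr.
exact: Mmul.
Qed.

Lemma jacobson_subr1X x n :
  jacobson_radical (x - 1) -> jacobson_radical (x ^+ n - 1).
Proof.
move=> Jx; elim: n => [|n IHn]; first by rewrite expr0 subrr; exact: jacobson0.
rewrite exprS -(subrK x (x * _)) -addrA; apply: jacobsonD => //.
by rewrite -[X in _ - X]mulr1 -mulrBr; exact: jacobsonM.
Qed.

(** Modulo the radical x is 1 and 2 is 0, so the sum is m, that is, 1. *)
Lemma jacobson_sum_powers_odd x m : jacobson_radical (2%:R : R) ->
  jacobson_radical (x - 1) -> odd m ->
  jacobson_radical (\sum_(i < m) x ^+ i - 1).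
Proof.
move=> J2 Jx m_odd.
have Jsum n : jacobson_radical (\sum_(i < n) x ^+ i - n%:R).
  elim: n => [|n IHn]; first by rewrite big_ord0 subrr; exact: jacobson0.
  rewrite big_ord_recr -natr1 opprD addrACA /=.
  by apply: jacobsonD => //; exact: jacobson_subr1X.
rewrite -(subrK m%:R (\sum_(i < m) _)) -addrA; apply: jacobsonD; first exact: Jsum.
rewrite -[m]odd_double_half m_odd natrD addrAC subrr add0r -muln2 natrM.
exact: jacobsonM.
Qed.

(** The factor y is a left inverse of the sum of the x^i for i < m, which
    multiplies x - 1 to x^m - 1. *)
Lemma jacobson_subr1_multiple x m : jacobson_radical (2%:R : R) ->
  jacobson_radical (x - 1) -> odd m -> exists y, y * (x ^+ m - 1) = x - 1.
Proof.
move=> J2 Jx m_odd.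
have /jacobsonN/jacobson_left_invertible[y] := jacobson_sum_powers_odd J2 Jx m_odd.
rewrite opprK addrC subrK => yN; exists y.
suff <- : (\sum_(i < m) x ^+ i) * (x - 1) = x ^+ m - 1 by rewrite mulrA yN mul1r.
elim: (m) => [|n IHn]; first by rewrite big_ord0 mul0r expr0 subrr.
by rewrite big_ord_recr mulrDl IHn /= mulrBr -exprSr mulr1 addrC addrA subrK.
Qed.

Lemma subr1X_pow2 x k :
  exists w, (x - 1) ^+ (2 ^ k) = x ^+ (2 ^ k) - 1 + w * 2%:R.
Proof.
elim: k => [|k [w Dw]]; first by exists 0; rewrite !expr1 mul0r addr0.
rewrite expnSr !exprM Dw; set X := x ^+ _.
have sqX : (X - 1) * (X - 1) = X * X - 1 + (1 - X) * 2%:R.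
  rewrite mulr_natr mulr2n mulrBr mulrBl mul1r mulr1 opprB -[RHS]addrA.
  by rewrite (addrA (-1)) addKr -addrA.
(* The square is expanded with X - 1 and 2 abstracted, lest distributivity
   split them further. *)
move: (X - 1) 2%:R sqX (commr_nat (X - 1) 2) => Y t sqX Yt.
exists (1 - X + (Y * w + (w * Y + w * t * w))).
have Y2 : w * t * Y = w * Y * t by rewrite -!mulrA Yt.
by rewrite !expr2 mulrDl !mulrDr sqX !mulrDl !mulrA Y2 -!addrA.
Qed.

(** If u = e + z and f = 1 - e, then f u^n = f z^n is in the radical, and
    cancelling u^n puts the idempotent f there: so f = 0 and u = 1 + z. *)
Lemma clean_unit_subr1 (u v : R) :
  strongly_Jsharp_clean R -> v * u = 1 -> Jsharp (u - 1).
Proof.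
move=> clR vu; have [e [z [Du ee [n [n_gt0 Jz]] ez]]] := clR u.
pose f := 1 - e.
have ff : f * f = f by rewrite /f mulrBl mul1r mulrBr mulr1 ee subrr subr0.
have fz : f * z = z * f by rewrite /f mulrBl mulrBr mul1r mulr1 ez.
have uf : u * f = z * f.
  by rewrite Du mulrDl {1}/f mulrBr mulr1 ee subrr add0r.
have unf : u ^+ n * f = f * z ^+ n.
  rewrite (commrX n fz); elim: (n) => [|k IHk]; first by rewrite !expr0.
  by rewrite exprSr -mulrA uf -fz mulrA IHk -mulrA fz mulrA -exprSr.
have vu1 : v ^+ n * u ^+ n = 1.
  elim: (n) => [|k IHk]; first by rewrite !expr0 mulr1.
  by rewrite exprSr exprS mulrA -(mulrA (v ^+ k)) vu mulr1 IHk.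
have f0 : f = 0.
  apply: jacobson_idempotent_eq0 => //.
  by rewrite -[f]mul1r -vu1 -mulrA unf; do 2!apply: jacobsonM.
exists n; split=> //; suff -> : u - 1 = z by [].
by rewrite Du -(subrK e 1) -/f f0 add0r addrAC subrr add0r.
Qed.

Lemma clean_jacobson2 : strongly_Jsharp_clean R -> jacobson_radical (2%:R : R).
Proof.
move=> clR; have N1 : (-1) * (-1) = 1 :> R by rewrite mulrNN mulr1.
have [n [_ Jn]] := clean_unit_subr1 clR N1.
rewrite -[2%:R]opprK; apply: jacobsonN; apply: (@jacobson_central_expr _ n).
  by move=> x; apply: commr_sym; apply: commrN; exact: commr_nat.
by rewrite mulr2n opprD.
Qed.

Lemma clean_unit_pow2 (u v : R) : strongly_Jsharp_clean R -> v * u = 1 ->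
  exists k, jacobson_radical (u ^+ (2 ^ k) - 1).
Proof.
move=> clR vu; have [k [_ Jk]] := clean_unit_subr1 clR vu.
exists k; have [w Dw] := subr1X_pow2 u k.
rewrite -[_ - 1](addrK (w * 2%:R)) -Dw; apply: jacobsonD.
  by rewrite -(subnK (ltnW (ltn_expl k (ltnSn 1)))) exprD; exact: jacobsonM.
by apply: jacobsonN; apply: jacobsonM; exact: clean_jacobson2.
Qed.

End Jacobson.

(** * Images of strongly J#-clean rings *)

Section Quotient.
Variables (S R : pzRingType) (f : {rmorphism S -> R}) (s : R -> S).
Hypothesis fK : cancel s f.

(** The preimage of a maximal left ideal M is again maximal: a left ideal I
    above it contains the kernel of f, so it is determined by its image, which
    is the set of the r with s r in I. *)
Lemma jacobson_surjective x : jacobson_radical x -> jacobson_radical (f x).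
Proof.
move=> Jx M [[M0 Madd Mmul] M1 Mmax]; apply: (Jx (fun y => M (f y))); split.
- split; first by rewrite rmorph0.
    by move=> y z My Mz; rewrite rmorphD; exact: Madd.
  by move=> a y My; rewrite rmorphM; exact: Mmul.
- by rewrite rmorph1.
- move=> I [I0 Iadd Imul] I1 MI y Iy.
  have kerI z t : I z -> f z = f t -> I t.
    move=> Iz ft; rewrite -(subrK z t); apply: Iadd => //; apply: MI.
    by rewrite rmorphB ft subrr.
  apply: (Mmax (fun r => I (s r))); last by apply: kerI Iy _; rewrite fK.
  + split; first by apply: kerI I0 _; rewrite fK rmorph0.
      by move=> a b Ia Ib; apply: kerI (Iadd _ _ Ia Ib) _; rewrite rmorphD !fK.
    by move=> a b Ib; apply: kerI (Imul (s a) _ Ib) _; rewrite rmorphM !fK.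
  + by move=> Is1; apply: I1; apply: kerI Is1 _; rewrite fK rmorph1.
  + by move=> r Mr; apply: MI; rewrite fK.
Qed.

Lemma clean_surjective : strongly_Jsharp_clean S -> strongly_Jsharp_clean R.
Proof.
move=> clS a; have [e [z [Da ee [n [n_gt0 Jz]] ez]]] := clS (s a).
exists (f e), (f z); rewrite -!rmorphM -rmorphD -Da ee ez fK; split=> //.
by exists n; split=> //; rewrite -rmorphXn; exact: jacobson_surjective.
Qed.

End Quotient.

(** * Augmentation and group elements in the group ring *)

Section GroupRing.
Variables (R : nzRingType) (G : groupType).
Implicit Types (x y : group_ring R G) (g h : G).

Definition augmentation x : R := \sum_(g <- msupp x) x@_g.

Lemma augmentationEw (d : {fset G}) x :
  (msupp x `<=` d)%fset -> augmentation x = \sum_(g <- d) x@_g.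
Proof. by move=> xd; apply: big_fset_incl => // g _ /mcoeff_outdom. Qed.

Lemma augmentationU c g : augmentation << c *g g >> = c.
Proof. by rewrite (augmentationEw msuppU_le) big_seq_fset1 mcoeffUU. Qed.

Fact augmentation_is_zmod_morphism : zmod_morphism augmentation.
Proof.
move=> x y; rewrite (augmentationEw (msuppB_le x y)).
rewrite (augmentationEw (fsubsetUl (msupp x) (msupp y))).
rewrite (augmentationEw (fsubsetUr (msupp x) (msupp y))) -sumrB.
by apply: eq_bigr => g _; rewrite mcoeffB.
Qed.

HB.instance Definition _ := GRing.isZmodMorphism.Build (group_ring R G) R
  augmentation augmentation_is_zmod_morphism.

Fact augmentation_is_monoid_morphism : monoid_morphism augmentation.
Proof.
split=> [|x y]; first exact: augmentationU.
rewrite raddf_sum /= mulr_suml; apply: eq_bigr => g _.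
rewrite raddf_sum /= mulr_sumr; apply: eq_bigr => h _.
exact: augmentationU.
Qed.

HB.instance Definition _ := GRing.isMonoidMorphism.Build (group_ring R G) R
  augmentation augmentation_is_monoid_morphism.

Definition gr_elt g : group_ring R G := << 1 *g g >>.

Lemma gr_eltM g h : gr_elt (g * h)%g = gr_elt g * gr_elt h.
Proof. by rewrite [RHS]gr_mulUU mulr1. Qed.

Lemma gr_eltX g n : gr_elt (g ^+ n)%g = gr_elt g ^+ n.
Proof.
by elim: n => [|n IHn]; rewrite ?expr0 ?expg0 // exprS expgS gr_eltM IHn.
Qed.

Lemma gr_elt_inj : injective gr_elt.
Proof.
move=> g h /(congr1 (mcoeff h)); rewrite !mcoeffU eqxx.
by case: eqP => // _ /eqP; rewrite eq_sym oner_eq0.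
Qed.

Lemma mcoeff_mul_elt x g k : (x * gr_elt g)@_k = x@_(k * g^-1)%g.
Proof.
rewrite [x * _]gr_mulUr [in RHS](monalgE x) !raddf_sum /=.
apply: eq_bigr => h _; rewrite mulr1 !mcoeffU; congr (_ *+ nat_of_bool _).
by rewrite (can2_eq (mulgK g) (mulgVK g)).
Qed.

Lemma mcoeff_injective_const x (s : nat -> G) : injective s ->
  (forall n, x@_(s n.+1) = x@_(s n)) -> x@_(s 0%N) = 0.
Proof.
move=> s_inj x_const; apply/eqP/negPn/negP => xs0.
have xs n : x@_(s n) = x@_(s 0%N) by elim: n => // n <-.
pose t := [seq s n | n <- iota 0 (size (msupp x)).+1].
have : (size t <= size (msupp x))%N.
  apply: uniq_leq_size; first by rewrite map_inj_uniq ?iota_uniq.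
  by move=> _ /mapP[n _ ->]; rewrite -mcoeff_neq0 xs.
by rewrite size_map size_iota ltnn.
Qed.

(** Suppose that h has infinite order. Comparing coefficients at k gives
    x(k h^-m) - x(k) = [k = h] - [k = 1], so x is constant along the sequence
    1, h^m, h^2m, ..., and along h^-m, h^-2m, ...: both constants vanish as the
    support is finite. At k = 1 this reads 0 - 0 = -1. The case m = 1 is
    excluded as h itself is then on the first sequence. *)
Lemma elt_subr1_multiple_torsion x h m : (1 < m)%N ->
  x * (gr_elt h ^+ m - 1) = gr_elt h - 1 ->
  exists2 n, (0 < n)%N & (h ^+ n)%g = 1%g.
Proof.
move=> m_gt1 xh; apply: contrapT => torsion_free.
have m_gt0 := ltnW m_gt1.
have hX_inj : injective (fun n => h ^+ n)%g.
  suff hX_le i j : (h ^+ i)%g = (h ^+ j)%g -> (i <= j)%N.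
    by move=> i j hij; apply/eqP; rewrite eqn_leq !hX_le.
  move=> hij; rewrite leqNgt; apply/negP => lt_ji; apply: torsion_free.
  by exists (i - j)%N; rewrite ?subn_gt0 // expgnFr 1?ltnW // hij divgg.
have xE k : x@_(k / h ^+ m)%g - x@_k = (h == k)%:R - (1%g == k)%:R.
  have := congr1 (mcoeff k) xh.
  by rewrite mulrBr mulr1 -gr_eltX !mcoeffB mcoeff_mul_elt !mcoeffU.
have x_period k : h != k -> 1%g != k -> x@_(k / h ^+ m)%g = x@_k.
  by move=> /negPf hk /negPf k1; apply/eqP; rewrite -subr_eq0 xE hk k1 subrr.
have h_neqX n : n != 1%N -> (h != h ^+ n)%g.
  by apply: contra => /eqP/(hX_inj 1%N) <-.
have X_neq1 n : (0 < n)%N -> (1 != h ^+ n)%g.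
  by apply: contraTneq => /(hX_inj 0%N) <-.
have x1 : x@_(1%g) = 0.
  rewrite -(expg0 h) -(muln0 m).
  apply: (mcoeff_injective_const (s := fun n => h ^+ (m * n))%g) => [i j /hX_inj/eqP|n].
    by rewrite eqn_mul2l gtn_eqF // => /eqP.
  rewrite -x_period ?X_neq1 ?h_neqX ?muln_gt0 ?m_gt0 //.
    by rewrite mulnS addnC expgnDr mulgK.
  by rewrite muln_eq1 gtn_eqF.
have xV : x@_(h ^- m)%g = 0.
  rewrite -[m in (h ^- m)%g]muln1.
  apply: (mcoeff_injective_const (s := fun n => h ^- (m * n.+1))%g) => [i j|n].
    by move=> /invg_inj/hX_inj/eqP; rewrite eqn_mul2l gtn_eqF // => /eqP[].
  have k_neq j : (h ^+ j != h ^- (m * n.+1))%g.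
    rewrite -(inj_eq (mulIg (h ^+ (m * n.+1))%g)) mulVg -expgnDr eq_sym X_neq1 //.
    by rewrite addn_gt0 muln_gt0 m_gt0 orbT.
  rewrite -[RHS]x_period ?(k_neq 0%N) ?(k_neq 1%N) //.
  by rewrite -invgM -expgnDr -mulnS.
have := xE 1%g; rewrite div1g xV x1 eqxx eq_sym (negPf (X_neq1 1%N isT)) subr0.
by move/eqP; rewrite sub0r eq_sym oppr_eq0 oner_eq0.
Qed.

End GroupRing.

(** * The theorem *)

Section Order.
Variable G : groupType.

Lemma has_order_pow2 (g : G) K : (g ^+ (2 ^ K) = 1)%g ->
  exists k, has_order g (2 ^ k)%N.
Proof.
move=> gK; pose P n := (0 < n)%N && (g ^+ n == 1)%g.
have exP : exists n, P n by exists (2 ^ K)%N; rewrite /P expn_gt0 gK eqxx.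
case: (ex_minnP exP) => d /andP[d_gt0 /eqP gd] dmin.
have : (d %| 2 ^ K)%N.
  rewrite /dvdn -leqn0 leqNgt; apply/negP => r_gt0.
  have := dmin (2 ^ K %% d)%N; rewrite /P r_gt0 leqNgt ltn_mod d_gt0.
  suff -> : (g ^+ (2 ^ K %% d))%g = 1%g by rewrite eqxx => /(_ isT).
  by move: gK; rewrite {1}(divn_eq (2 ^ K) d) expgnDr mulnC expgnA gd expg1n mul1g.
case/dvdn_pfactor => // k _ Dd; exists k; rewrite -Dd; split=> // m m_gt0 gm.
by apply: dmin; rewrite /P m_gt0 gm eqxx.
Qed.

End Order.

Theorem theorem3p2 (R : nzRingType) (G : groupType)
    (hRG : strongly_Jsharp_clean (group_ring R G)) :
  strongly_Jsharp_clean R /\ two_group G.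
Proof.
split.
  apply: (clean_surjective (f := @augmentation R G) (s := fun c => << c *g 1%g >>)).
    by move=> c; exact: augmentationU.
  exact: hRG.
move=> g.
have J2 := clean_jacobson2 hRG.
have gV : gr_elt R g^-1%g * gr_elt R g = 1 by rewrite -gr_eltM mulVg.
have [k] := clean_unit_pow2 hRG gV; rewrite -gr_eltX.
set h := (g ^+ _)%g => Jh.
(* Any odd number above 1 would do in place of 3. *)
have [x xh] := jacobson_subr1_multiple (m := 3) J2 Jh isT.
have [n n_gt0 hn] := elt_subr1_multiple_torsion (m := 3) isT xh.
have [m] := pfactor_coprime (isT : prime 2) n_gt0.
rewrite coprime2n; set a := logn 2 n => m_odd Dn.
have Jha : jacobson_radical (gr_elt R h ^+ (2 ^ a) - 1) by exact: jacobson_subr1X.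
have [y] := jacobson_subr1_multiple J2 Jha m_odd.
rewrite -exprM mulnC -Dn -!gr_eltX hn subrr mulr0 => /esym/subr0_eq.
move=> /gr_elt_inj; rewrite -expgnA -expnD.
exact: has_order_pow2.
Qed.
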